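(* Let $(X,d,W)$ be a complete $UCW$-hyperbolic space, let $C=\bigcup_{k=1}^{p}C_k$ be a union of nonempty closed convex subsets $C_k$ of $X$ ($p\ge 1$ an integer), and let $T:C\to C$ be $\lambda$-firmly nonexpansive for some $\lambda\in(0,1)$. The following two statements are equivalent: (i) $T$ has bounded orbits; (ii) $T$ has fixed points.
   Context: A $W$-hyperbolic space $(X,d,W)$ is a metric space $(X,d)$ together with a map $W:X\times X\times[0,1]\to X$ (a convexity mapping) such that for all $x,y,z,w\in X$ and $\lambda,\tilde\lambda\in[0,1]$: (W1) $d(z,W(x,y,\lambda))\le(1-\lambda)d(z,x)+\lambda d(z,y)$; (W2) $d(W(x,y,\lambda),W(x,y,\tilde\lambda))=|\lambda-\tilde\lambda|\,d(x,y)$; (W3) $W(x,y,\lambda)=W(y,x,1-\lambda)$; (W4) $d(W(x,z,\lambda),W(y,w,\lambda))\le(1-\lambda)d(x,y)+\lambda d(z,w)$. One writes $(1-\lambda)x\oplus\lambda y:=W(x,y,\lambda)$. A subset $C\subseteq X$ is convex if $W(x,y,\lambda)\in C$ for all $x,y\in C$, $\lambda\in[0,1]$. A modulus of uniform convexity for $(X,d,W)$ is a map $\eta:(0,\infty)\times(0,2]\to(0,1]$ such that for all $r>0$, $\varepsilon\in(0,2]$ and $a,x,y\in X$: if $d(x,a)\le r$, $d(y,a)\le r$ and $d(x,y)\ge\varepsilon r$, then $d(\frac12x\oplus\frac12y,a)\le(1-\eta(r,\varepsilon))r$. It is monotone if it decreases (is nonincreasing) in $r$ for each fixed $\varepsilon$.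 A $UCW$-hyperbolic space is a $W$-hyperbolic space admitting a monotone modulus of uniform convexity; it is complete if the metric space $(X,d)$ is complete. For $C\subseteq X$ and $\lambda\in(0,1)$, a map $T:C\to X$ is $\lambda$-firmly nonexpansive if $d(Tx,Ty)\le d((1-\lambda)x\oplus\lambda Tx,(1-\lambda)y\oplus\lambda Ty)$ for all $x,y\in C$. Such a map is nonexpansive, i.e. $d(Tx,Ty)\le d(x,y)$ for all $x,y\in C$. For a nonexpansive $T:C\to C$, the orbit of $x\in C$ is $\{T^nx\mid n=0,1,2,\ldots\}$; $T$ has bounded orbits if the orbit of some (equivalently, every) $x\in C$ is bounded. *)

(* Defs.v *)
From HB Require Import structures.
From mathcomp Require Import all_boot all_order all_algebra.
From mathcomp Require Import all_classical all_reals all_analysis.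
From mathcomp Require Import lra.

Set Implicit Arguments.
Unset Strict Implicit.
Unset Printing Implicit Defensive.

Import Order.TTheory GRing.Theory Num.Theory.

Local Open Scope classical_set_scope.
Local Open Scope ring_scope.

#[short(type="completeMetricType")]
HB.structure Definition CompleteMetric (R : numDomainType) :=
  {X of Complete X & Metric R X}.

(* Maps with domain [0, 1], ]0, +oo[ x ]0, 2] or C are represented by total
   functions; every condition below only constrains their values on the
   intended domain. *)

Section hyperbolic.
Context {R : realType} {X : metricType R}.
Implicit Types (W : X -> X -> R -> X) (eta : R -> R -> R) (C : set X).

(* W x y l is (1 - l) x (+) l y, so that W x y 0 = x and W x y 1 = y. *)
Record w_hyperbolic W : Prop := WHyperbolic {
  W1 : forall x y z l, 0 <= l <= 1 ->
    mdist z (W x y l) <= (1 - l) * mdist z x + l * mdist z y ;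
  W2 : forall x y l l', 0 <= l <= 1 -> 0 <= l' <= 1 ->
    mdist (W x y l) (W x y l') = `|l - l'| * mdist x y ;
  W3 : forall x y l, 0 <= l <= 1 -> W x y l = W y x (1 - l) ;
  W4 : forall x y z w l, 0 <= l <= 1 ->
    mdist (W x z l) (W y w l) <= (1 - l) * mdist x y + l * mdist z w
}.

Definition w_convex W C :=
  forall x y l, C x -> C y -> 0 <= l <= 1 -> C (W x y l).

Record uc_modulus W eta : Prop := UCModulus {
  uc_modulus_range : forall r e, 0 < r -> 0 < e <= 2 -> 0 < eta r e <= 1 ;
  uc_modulus_midpoint : forall r e a x y, 0 < r -> 0 < e <= 2 ->
    mdist x a <= r -> mdist y a <= r -> e * r <= mdist x y ->
    mdist (W x y (2^-1)) a <= (1 - eta r e) * r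
}.

Definition monotone_modulus eta :=
  forall r s e, 0 < r -> r <= s -> 0 < e <= 2 -> eta s e <= eta r e.

Definition ucw_hyperbolic W :=
  w_hyperbolic W /\ exists eta, uc_modulus W eta /\ monotone_modulus eta.

Definition firmly_nonexpansive W (l : R) C (T : X -> X) :=
  forall x y, C x -> C y ->
    mdist (T x) (T y) <= mdist (W x (T x) l) (W y (T y) l).

Definition nonexpansive C (T : X -> X) :=
  forall x y, C x -> C y -> mdist (T x) (T y) <= mdist x y.

Definition iter_orbit (T : X -> X) (x : X) : set X := range (fun n => iter n T x).

(* The library's bounded_set is restricted to normed spaces. *)
Definition metric_bounded (A : set X) :=
  exists M, forall x y, A x -> A y -> mdist x y <= M.

Definition has_bounded_orbits C (T : X -> X) :=
  exists x, C x /\ metric_bounded (iter_orbit T x).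

Definition has_fixed_point C (T : X -> X) := exists x, C x /\ T x = x.

Lemma firmly_nonexpansive_nonexpansive W l C T :
  w_hyperbolic W -> 0 < l < 1 -> set_fun C C T ->
  firmly_nonexpansive W l C T -> nonexpansive C T.
Proof.
move=> hW /andP[l0 l1] _ hT x y Cx Cy.
have l01 : 0 <= l <= 1 by rewrite !ltW.
have h := le_trans (hT _ _ Cx Cy) (W4 hW x y (T x) (T y) l01).
by rewrite -(ler_pM2l (_ : 0 < 1 - l)) ?subr_gt0//; lra.
Qed.

(* In has_bounded_orbits, "some point of C" may be replaced by "every point
   of C". *)
Lemma has_bounded_orbits_forall C T :
  set_fun C C T -> nonexpansive C T -> has_bounded_orbits C T ->
  forall x, C x -> metric_bounded (iter_orbit T x).
Proof.
move=> TC hT [y [Cy [M hM]]] x Cx.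
have iterC z n : C z -> C (iter n T z).
  by move=> Cz; elim: n => //= n; exact: TC.
have dxy n : mdist (iter n T x) (iter n T y) <= mdist x y.
  by elim: n => //= n; apply: le_trans; apply: hT; exact: iterC.
exists (mdist x y + M + mdist x y) => _ _ [m _ <-] [n _ <-].
have hmn : mdist (iter m T y) (iter n T y) <= M.
  by apply: hM; [exists m|exists n].
have h1 := metric_triangle (iter m T x) (iter m T y) (iter n T x).
have h2 := metric_triangle (iter m T y) (iter n T y) (iter n T x).
have := dxy m; have := dxy n; rewrite [mdist (iter n T x) _]metric_sym.
by lra.
Qed.

End hyperbolic.

(* Main.v *)
(* Let r y be the limsup of d(T^n x, y), the asymptotic radius of a bounded
   orbit at y.  Uniform convexity gives r exactly one minimizer on each C_k, so
   r has at least one and at most p minimizers on C.  As T is nonexpansive, r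
   does not increase along T, so T maps this finite set into itself and some
   minimizer u satisfies T^(m+1) u = u.  On a periodic orbit
   a_k = d(T^i u, T^(i+k) u) does not depend on i, and firm nonexpansiveness
   makes a convex in k; since a_0 = a_(m+1) = 0 this forces a_1 = 0, that is
   T u = u. *)
Require Import Defs.
From mathcomp Require Import all_boot all_order all_algebra.
From mathcomp Require Import all_classical all_reals all_analysis.
From mathcomp Require Import lra.

Import Order.TTheory GRing.Theory Num.Theory.

Local Open Scope classical_set_scope.
Local Open Scope ring_scope.

(** * Periodic points of firmly nonexpansive maps *)

Section periodic.
Context {R : realType} {X : metricType R}.
Variables (W : X -> X -> R -> X) (C : set X) (T : X -> X) (l : R).
Hypotheses (W_hyp : w_hyperbolic W) (l01 : 0 < l < 1) (TC : set_fun C C T)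
  (T_firm : firmly_nonexpansive W l C T).

Lemma iter_set_fun (x : X) (n : nat) : C x -> C (iter n T x).
Proof. by move=> Cx; elim: n => //= n; exact: TC. Qed.

(** [W1] is applied in each argument of the distance that bounds [mdist (T x) (T y)]. At two points
    of one periodic orbit this becomes the convexity inequality. *)
Lemma firmly_nonexpansive_W1 (x y : X) : C x -> C y ->
  mdist (T x) (T y) <=
  (1 - l) * ((1 - l) * mdist x y + l * mdist (T x) y) +
  l * ((1 - l) * mdist x (T y) + l * mdist (T x) (T y)).
Proof.
move=> Cx Cy; have /andP[l0 l1] := l01.
have l01' : 0 <= l <= 1 by rewrite !ltW.
apply: (le_trans (T_firm _ _ Cx Cy)); apply: (le_trans (W1 W_hyp _ _ _ l01')).
have W1l a b c : mdist (W a b l) c <= (1 - l) * mdist a c + l * mdist b c.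
  by rewrite !(metric_sym _ c) W1.
by rewrite lerD// ler_wpM2l// ltW// subr_gt0.
Qed.

Lemma firmly_nonexpansive_periodic (x : X) (m : nat) :
  C x -> iter m.+1 T x = x -> T x = x.
Proof.
move=> Cx Tmx.
have T_ne := firmly_nonexpansive_nonexpansive W_hyp l01 TC T_firm.
pose b i k := mdist (iter i T x) (iter (i + k) T x).
have b_decr k i j : b (j + i)%N k <= b i k.
  elim: j => // j; apply: le_trans; rewrite /b !addSn.
  by apply: T_ne; exact: iter_set_fun.
have iter_per j : iter (j * m.+1) T x = x.
  by elim: j => // j IH; rewrite mulSn iterD IH.
(* [b i k] is nonincreasing in [i] and returns to [b 0 k] at [i * m.+1 >= i], so it is constant in
   [i]. *)
have bE i k : b i k = b 0 k.
  apply: le_anti; rewrite -{1}(addn0 i) b_decr/=.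
  have -> : b 0 k = b (i * m.+1)%N k.
    by rewrite /b add0n addnC iterD iter_per.
  by rewrite mulnS addnC b_decr.
have b_convex k : 2 * b 0 k.+1 <= b 0 k + b 0 k.+2.
  have /andP[l0 l1] := l01.
  have := firmly_nonexpansive_W1 (iter 0 T x) (iter k.+1 T x) Cx
    (iter_set_fun _ _ Cx).
  rewrite -/(b 0 k.+1) -/(b 0 k.+2) -!iterS -/(b 1 k) -/(b 1 k.+1) !bE => h.
  (* Since [1 - (1 - l)^2 - l^2 = 2 l (1 - l)], the inequality [h] is the goal multiplied by
     [l (1 - l) > 0]. *)
  rewrite -subr_ge0 -(pmulr_rge0 _ (_ : 0 < l * (1 - l))) ?mulr_gt0 ?subr_gt0//.
  by rewrite -subr_ge0 in h; apply: le_trans h _; lra.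
have b_incr k : b 0 k <= b 0 k.+1.
  elim: k => [|k IH]; first by rewrite {1}/b addn0 mdistxx mdist_ge0.
  by have := b_convex k; lra.
have b_ge k : b 0 1 <= b 0 k.+1 by elim: k => // k /le_trans; exact.
apply/esym/mdist_positivity/le_anti; rewrite mdist_ge0 andbT.
by rewrite (le_trans (b_ge m))// /b add0n Tmx mdistxx.
Qed.

End periodic.

(** * Asymptotic radius of a bounded sequence *)

Section asymptotic_radius.
Context {R : realType} {X : metricType R}.
Variable u : nat -> X.

(** The limsup as the infimum of all eventual upper bounds, so that estimates on it translate into
    statements about all large [n]. *)
Definition asymptotic_radius (y : X) : R :=
  inf [set s | \forall n \near \oo, mdist (u n) y <= s].

Lemma asymptotic_radius_le (y : X) (s : R) :
  (\forall n \near \oo, mdist (u n) y <= s) -> asymptotic_radius y <= s.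
Proof.
apply: ge_inf; exists 0 => t [N _ /(_ N (leqnn N))].
exact/le_trans/mdist_ge0.
Qed.

Hypothesis u_bnd : metric_bounded (range u).

Lemma asymptotic_radius_has_bound (y : X) :
  [set s | \forall n \near \oo, mdist (u n) y <= s] !=set0.
Proof.
case: u_bnd => M uM; exists (M + mdist (u 0) y); exists 0%N => // n _ /=.
by rewrite (le_trans (metric_triangle _ (u 0) _))// lerD2r uM//; eexists.
Qed.

Lemma asymptotic_radius_ge0 (y : X) : 0 <= asymptotic_radius y.
Proof.
apply: (lb_le_inf (asymptotic_radius_has_bound y)).
by move=> t [N _ /(_ N (leqnn N))]; exact/le_trans/mdist_ge0.
Qed.

Lemma asymptotic_radius_lt (y : X) (s : R) :
  asymptotic_radius y < s -> \forall n \near \oo, mdist (u n) y <= s.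
Proof.
move=> /(inf_lt (asymptotic_radius_has_bound y))[t [N _ ut] ts].
by exists N => // n /ut /le_trans; apply; exact: ltW.
Qed.

Lemma asymptotic_radius_triangle (y z : X) :
  asymptotic_radius z <= asymptotic_radius y + mdist y z.
Proof.
apply/ler_addgt0Pr => e e0.
have [N _ uy] : \forall n \near \oo, mdist (u n) y <= asymptotic_radius y + e.
  by apply: asymptotic_radius_lt; rewrite ltrDl.
apply: asymptotic_radius_le; exists N => // n /uy /= uny.
by rewrite (le_trans (metric_triangle _ y _))// addrAC lerD2r.
Qed.

Lemma mdist_le_asymptotic_radius (y z : X) (s : R) :
  asymptotic_radius y < s -> asymptotic_radius z < s -> mdist y z <= 2 * s.
Proof.
move=> /asymptotic_radius_lt ys /asymptotic_radius_lt zs.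
have [N _ /(_ N (leqnn N))[uy uz]] := filterI ys zs.
apply: le_trans (metric_triangle _ (u N) _) _.
by rewrite mulrDl mul1r (metric_sym y) lerD.
Qed.

(** If two points of radius below [s] were [e] apart, uniform convexity would give their midpoint a
    radius below [rho]. As [s] does not depend on the points, this yields both uniqueness of
    minimizers and the Cauchy property of minimizing sequences. *)
Lemma near_minimizers_close (W : X -> X -> R -> X) (D : set X) (rho e : R) :
  ucw_hyperbolic W -> w_convex W D -> 0 <= rho ->
  (forall y, D y -> rho <= asymptotic_radius y) -> 0 < e ->
  exists2 s, rho < s & forall y z, D y -> D z ->
    asymptotic_radius y < s -> asymptotic_radius z < s -> mdist y z < e.
Proof.
move=> [W_hyp [eta [eta_uc eta_mono]]] D_convex rho_ge0 rho_min e0.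
have [rho0|rho0] := eqVneq rho 0.
  (* The modulus needs a positive radius; here the bound [2 * s] on the distance is enough. *)
  exists (e / 3); first by rewrite rho0 divr_gt0.
  move=> y z _ _ ys zs.
  by apply: le_lt_trans (mdist_le_asymptotic_radius _ _ _ ys zs) _; lra.
have {rho0} rho_gt0 : 0 < rho by rewrite lt_neqAle eq_sym rho0.
(* The level [s] will depend on [h = eta K d], so the modulus is first taken at a fixed [K >= s];
   monotonicity then gives [h <= eta s d]. *)
pose K := 2 * rho; pose d := e / K.
have K0 : 0 < K by rewrite mulr_gt0.
have d0 : 0 < d by rewrite divr_gt0.
have dK : d * K = e by rewrite divfK// gt_eqF.
(* For [d > 2], outside the domain of the modulus, [2 * K < e] settles the claim. *)
have [d2|d2] := ltP 2 d.
  exists K; first by rewrite /K; lra.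
  move=> y z _ _ ys zs.
  apply: le_lt_trans (mdist_le_asymptotic_radius _ _ _ ys zs) _.
  by rewrite -dK ltr_pM2r.
have d02 : 0 < d <= 2 by rewrite d0.
have /andP[h0 h1] := uc_modulus_range eta_uc K0 d02.
set h := eta K d in h0 h1.
(* With this choice [(1 - h) * s = rho * (1 - h^2) < rho], and [h <= 1] gives [s <= K]. *)
exists (rho * (1 + h)); first by rewrite ltr_pMr// ltrDl.
set s := rho * (1 + h) => y z Dy Dz ys zs; rewrite ltNge; apply/negP => eyz.
have s0 : 0 < s by rewrite mulr_gt0// addr_gt0.
have sK : s <= K by rewrite /s /K mulrC ler_pM2r//; lra.
have hs : h <= eta s d by exact: eta_mono.
have dyz : d * s <= mdist y z by rewrite (le_trans _ eyz)// -dK ler_pM2l.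
have Dw : D (W y z 2^-1) by apply: D_convex => //; lra.
have : asymptotic_radius (W y z 2^-1) <= (1 - h) * s.
  apply: asymptotic_radius_le.
  have [N _ uyz] := filterI (asymptotic_radius_lt _ _ ys)
    (asymptotic_radius_lt _ _ zs).
  exists N => // n /uyz[/= uy uz]; rewrite metric_sym.
  apply: (@le_trans _ _ ((1 - eta s d) * s)).
    by apply: (uc_modulus_midpoint eta_uc) => //; rewrite metric_sym.
  by rewrite ler_pM2r//; lra.
apply/negP; rewrite -ltNge (lt_le_trans _ (rho_min _ Dw))//.
by rewrite /s mulrCA -subr_gt0 (_ : _ - _ = rho * h * h) ?mulr_gt0//; lra.
Qed.

End asymptotic_radius.

(** * Asymptotic centers in closed convex sets *)

Lemma asymptotic_center_unique (R : realType) (X : metricType R) (u : nat -> X)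
    (W : X -> X -> R -> X) (D : set X) (y z : X) :
  metric_bounded (range u) -> ucw_hyperbolic W -> w_convex W D -> D y -> D z ->
  (forall x, D x -> asymptotic_radius u y <= asymptotic_radius u x) ->
  (forall x, D x -> asymptotic_radius u z <= asymptotic_radius u x) ->
  y = z.
Proof.
move=> u_bnd W_ucw D_convex Dy Dz y_min z_min; apply: contrapT => yz.
have e0 : 0 < mdist y z by rewrite mdist_gt0; apply/eqP.
have ry0 := asymptotic_radius_ge0 u u_bnd y.
(* Taking [e = mdist y z] yields [mdist y z < mdist y z]. *)
have [s ys close] :=
  near_minimizers_close u u_bnd W D _ _ W_ucw D_convex ry0 y_min e0.
have := close _ _ Dy Dz ys (le_lt_trans (z_min _ Dy) ys).
by rewrite ltxx.
Qed.

(** A minimizing sequence is Cauchy because near minimizers are close; its limit lies in the closed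
    set [D] and is minimal because the radius is 1-Lipschitz. *)
Lemma asymptotic_center_exists (R : realType) (X : completeMetricType R)
    (u : nat -> X) (W : X -> X -> R -> X) (D : set X) :
  metric_bounded (range u) -> ucw_hyperbolic W -> D !=set0 -> closed D ->
  w_convex W D ->
  exists2 y, D y &
    forall x, D x -> asymptotic_radius u y <= asymptotic_radius u x.
Proof.
move=> u_bnd W_ucw [x0 Dx0] D_closed D_convex.
pose r := asymptotic_radius u; pose rho := inf [set r x | x in D].
have rD : [set r x | x in D] !=set0 by exists (r x0); exists x0.
have rho_ge0 : 0 <= rho.
  by apply: lb_le_inf => // _ [x _ <-]; exact: asymptotic_radius_ge0.
have rho_min x : D x -> rho <= r x.
  move=> Dx; apply: ge_inf; last by exists x.
  by exists 0 => _ [y _ <-]; exact: asymptotic_radius_ge0.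
have /choice[v v_min] n : exists y, D y /\ r y < rho + n.+1%:R^-1.
  have : rho < rho + n.+1%:R^-1 by rewrite ltrDl.
  by move=> /(inf_lt rD)[_ [y Dy <-] ry]; exists y.
have v_near s : rho < s -> \forall n \near \oo, r (v n) < s.
  rewrite -subr_gt0 => s0.
  have [N _ Ns] := near_infty_natSinv_lt (PosNum s0).
  exists N => // n /Ns /= ns; have [_ /lt_trans] := v_min n; apply.
  by rewrite -ltrBrDl.
have v_cvg : cvg (v @ \oo).
  apply: cauchy_cvg; apply: cauchy_exP => e e0.
  have [s rs close] :=
    near_minimizers_close u u_bnd W D _ _ W_ucw D_convex rho_ge0 rho_min e0.
  have [N _ Ns] := v_near s rs.
  exists (v N); exists N => // n Nn; rewrite /= ballEmdist /=.
  by apply: close; [exact: (v_min N).1|exact: (v_min n).1| |]; apply: Ns => /=.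
have /cvg_ex[y vy] := v_cvg.
have Dy : D y.
  apply: (closed_cvg D D_closed _ y vy).
  by apply: nearW => n; exact: (v_min n).1.
exists y => // x /rho_min; apply: le_trans; apply/ler_addgt0Pr => e e0.
have e20 : 0 < e / 2 by rewrite divr_gt0.
have rho_lt : rho < rho + e / 2 by rewrite ltrDl.
have [N _ /(_ N (leqnn N)) [/= vNy rvN]] :=
  filterI (metricType_numDomainType.cvgr_dist_lt vy e20) (v_near _ rho_lt).
have := asymptotic_radius_triangle u u_bnd (v N) y.
by rewrite -/r [mdist (v N) _]metric_sym; lra.
Qed.

(** * Bounded orbits and fixed points *)

Lemma asymptotic_radius_iter (R : realType) (X : metricType R) (C : set X)
    (T : X -> X) (x y : X) :
  set_fun C C T -> nonexpansive C T -> C x -> C y ->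
  metric_bounded (iter_orbit T x) ->
  asymptotic_radius (fun n => iter n T x) (T y) <=
  asymptotic_radius (fun n => iter n T x) y.
Proof.
move=> TC T_ne Cx Cy Tx_bnd; apply/ler_addgt0Pr => e e0.
apply: asymptotic_radius_le.
have [N _ TN] : \forall n \near \oo, mdist (iter n T x) y <=
    asymptotic_radius (fun n => iter n T x) y + e.
  by apply: asymptotic_radius_lt => //; rewrite ltrDl.
(* The bound at index [n] for [y] gives the one at [n.+1] for [T y]. *)
exists N.+1 => // -[//|n] /= /TN; apply: le_trans; apply: T_ne => //.
exact: iter_set_fun.
Qed.

Theorem theorem4p1 (R : realType) (X : completeMetricType R)
    (W : X -> X -> R -> X) (p : nat) (C_ : 'I_p -> set X) (C : set X)
    (T : X -> X) (l : R)
    (W_ucw : ucw_hyperbolic W)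
    (p_ge1 : (1 <= p)%N)
    (C_neq0 : forall k, C_ k !=set0)
    (C_closed : forall k, closed (C_ k))
    (C_convex : forall k, w_convex W (C_ k))
    (C_def : C = \bigcup_(k in [set: 'I_p]) C_ k)
    (TC : set_fun C C T)
    (l01 : 0 < l < 1)
    (T_firm : firmly_nonexpansive W l C T) :
  has_bounded_orbits C T <-> has_fixed_point C T.
Proof.
have [W_hyp _] := W_ucw.
have T_ne := firmly_nonexpansive_nonexpansive W_hyp l01 TC T_firm.
split=> [[x [Cx Tx_bnd]]|[x [Cx Tx]]]; last first.
  exists x; split=> //; exists 0 => _ _ [m _ <-] [n _ <-].
  by rewrite !iter_fix// mdistxx.
pose r := asymptotic_radius (fun n => iter n T x).
have /choice[c c_min] k : exists y, C_ k y /\ forall z, C_ k z -> r y <= r z.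
  have [y Cy y_min] := asymptotic_center_exists _ _ _ W _ Tx_bnd W_ucw
    (C_neq0 k) (C_closed k) (C_convex k).
  by exists y.
(* The best of the [p] centers minimizes [r] on all of [C]; [p_ge1] provides the default index. *)
pose k0 := [arg min_(k < Ordinal p_ge1) r (c k)]%O.
pose y := c k0.
have Cy : C y by rewrite C_def; exists k0 => //; exact: (c_min k0).1.
have y_min z : C z -> r y <= r z.
  rewrite C_def => -[k _ Ckz]; apply: le_trans ((c_min k).2 z Ckz).
  by rewrite /y /k0; case: arg_minP => // i _ /(_ k); apply.
have Ty_C n : C (iter n T y) by exact: iter_set_fun.
have Ty_min n z : C z -> r (iter n T y) <= r z.
  move=> /y_min; apply: le_trans; elim: n => //= n; apply: le_trans.
  exact: (asymptotic_radius_iter _ _ C _ _ _ TC T_ne Cx (Ty_C n) Tx_bnd).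
have /choice[f Cf] n : exists k, C_ k (iter n T y).
  by have := Ty_C n; rewrite {1}C_def => -[k _ Ck]; exists k.
(* Pigeonhole: the [p.+1] iterates of index [0] to [p] lie in [p] pieces. *)
have [i [j ij fij]] : exists i, exists2 j, (i < j)%N & f i = f j.
  have : ~~ injectiveb (fun i : 'I_p.+1 => f i).
    by apply/injectiveP => /leq_card; rewrite !card_ord ltnn.
  move=> /injectivePn[i [j]]; rewrite -val_eqE neq_ltn => /orP[] ij fij.
    by exists i, j.
  by exists j, i.
(* Both iterates minimize [r] on the same convex piece, where the minimizer is unique. *)
have Tij : iter j T y = iter i T y.
  have CkC z : C_ (f i) z -> C z by rewrite C_def; exists (f i).
  apply: (asymptotic_center_unique _ _ _ W (C_ (f i)) _ _ Tx_bnd W_ucw) => //.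
  - by rewrite fij.
  - by move=> z /CkC; exact: Ty_min.
  - by move=> z /CkC; exact: Ty_min.
exists (iter i T y); split=> //.
(* The period is [j - i > 0], passed as the predecessor since the lemma is stated for [m.+1]. *)
apply: (firmly_nonexpansive_periodic W C T l W_hyp l01 TC T_firm _
  (j - i).-1) => //.
by rewrite prednK ?subn_gt0// -iterD subnK// ltnW.
Qed.
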